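(* Assume $f$ is globally Lipschitz and of linear growth: there are constants $L,C_f\ge0$ with $\|f(q_1)-f(q_2)\|\le L\|q_1-q_2\|$ and $\|f(q)\|\le C_f(1+\|q\|)$ for all $q_1,q_2,q\in\mathbb{R}^d$. Let $T>0$ and $k\in\mathbb{N}$. Then there is $h_0>0$ such that for all $h\le h_0$ with $N=T/h\in\mathbb{N}$, $$\sup_{n\in\{1,\dots,N\}}\mathbf{E}\big[\|P^h[n]\|^k+\|Q^h[n]\|^k\big]\le C<\infty,$$ where $C$ does not depend on $h$ (it depends on $T$, $k$, the initial value and the coefficients).
   Context: Let $d\le m$, $F\in C^\infty(\mathbb{R}^d,\mathbb{R})$, $f=\nabla F$, $M\in\mathbb{R}^{d\times d}$ symmetric positive definite, $v>0$, $\sigma=(\sigma_1,\dots,\sigma_m)\in\mathbb{R}^{d\times m}$, $W$ a standard $m$-dimensional Wiener process. For a step size $h>0$, $t_n=nh$, $\Delta_{n+1}W=W(t_{n+1})-W(t_n)$, the scheme started at a deterministic $(P^h[0],Q^h[0])=(p,q)$ is $$P^h[n+1]=e^{-vh}P^h[n]-\tfrac{h^2}{2}\nabla^2F(Q^h[n])MP^h[n+1]-h\big(1+\tfrac{vh}{2}\big)e^{-vh}f(Q^h[n])-\big(1+\tfrac{vh}{2}\big)e^{-vh}\sigma\Delta_{n+1}W,$$ $$Q^h[n+1]=Q^h[n]+h\big(1-\tfrac{vh}{2}\big)e^{vh}MP^h[n+1]+\tfrac{h^2}{2}Mf(Q^h[n])+\tfrac{h}{2}M\sigma\Delta_{n+1}W,$$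 with the first equation solved for $P^h[n+1]$. *)

(* Defs.v *)
From HB Require Import structures.
From mathcomp Require Import all_boot all_order all_algebra.
From mathcomp Require Import all_classical all_reals all_analysis.
Set Implicit Arguments. Unset Strict Implicit. Unset Printing Implicit Defensive.
Import Order.TTheory GRing.Theory Num.Theory.
Import numFieldNormedType.Exports.
Local Open Scope classical_set_scope.
Local Open Scope ring_scope.

Section Defs.
Variable R : realType.

Definition enorm (n : nat) (x : 'cV[R]_n) : R :=
  Num.sqrt (\sum_(i < n) (x i 0) ^+ 2).

Definition ebasis (n : nat) (i : 'I_n) : 'cV[R]_n := delta_mx i 0.

Fixpoint iterD (n : nat) (vs : seq 'cV[R]_n) (F : 'cV[R]_n -> R) : 'cV[R]_n -> R :=
  match vs with
  | [::] => F
  | v :: vs' => fun x => 'D_v (iterD vs' F) x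
  end.

Definition smooth (n : nat) (F : 'cV[R]_n -> R) : Prop :=
  forall (vs : seq 'cV[R]_n) (x : 'cV[R]_n), differentiable (iterD vs F) x.

Definition grad (n : nat) (F : 'cV[R]_n -> R) (q : 'cV[R]_n) : 'cV[R]_n :=
  \col_i 'D_(ebasis i) F q.

Definition hessian (n : nat) (F : 'cV[R]_n -> R) (q : 'cV[R]_n) : 'M[R]_n :=
  \matrix_(i, j) 'D_(ebasis i) ('D_(ebasis j) F) q.

Definition sym_pos_def (n : nat) (M : 'M[R]_n) : Prop :=
  M^T = M /\ forall x : 'cV[R]_n, x != 0 -> 0 < (x^T *m M *m x) 0 0.

Section Prob.
Context {dO : measure_display} {Omega : measurableType dO}.
Variable P : probability Omega R.

Definition mutually_independent (I : finType) (X : I -> Omega -> R) : Prop :=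
  forall B : I -> set R, (forall i, measurable (B i)) ->
    P (\bigcap_(i in [set: I]) (X i @^-1` B i)) =
    (\prod_(i : I) P (X i @^-1` B i))%E.

Definition std_wiener (m : nat) (W : 'I_m -> R -> Omega -> R) : Prop :=
  (forall j t, measurable_fun setT (W j t)) /\
  (forall j w, W j 0 w = 0) /\
  (forall j w, {within [set t : R | 0 <= t], continuous (fun t => W j t w)}) /\
  (forall (n : nat) (t : nat -> R), 0 <= t 0%N ->
     (forall i, (i < n)%N -> t i < t i.+1) ->
     let X := fun ji : 'I_m * 'I_n =>
                fun w => W ji.1 (t ji.2.+1) w - W ji.1 (t ji.2) w in
     mutually_independent X /\
     forall ji : 'I_m * 'I_n, forall B : set R, measurable B ->
       P (X ji @^-1` B) =
       normal_prob 0 (Num.sqrt (t ji.2.+1 - t ji.2)) B).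

End Prob.

Definition scheme_step (d m : nat) (F : 'cV[R]_d -> R) (M : 'M[R]_d) (v : R)
  (sigma : 'M[R]_(d, m)) (h : R) (PQ : 'cV[R]_d * 'cV[R]_d) (dW : 'cV[R]_m)
  : 'cV[R]_d * 'cV[R]_d :=
  let p := PQ.1 in let q := PQ.2 in
  let a := expR (- (v * h)) in
  let Pn := invmx (1%:M + (h ^+ 2 / 2) *: (hessian F q *m M)) *m
              (a *: p - (h * (1 + v * h / 2) * a) *: grad F q
                      - ((1 + v * h / 2) * a) *: (sigma *m dW)) in
  let Qn := q + (h * (1 - v * h / 2) * expR (v * h)) *: (M *m Pn)
              + (h ^+ 2 / 2) *: (M *m grad F q)
              + (h / 2) *: (M *m (sigma *m dW)) in
  (Pn, Qn).

Fixpoint scheme {Omega : Type} (d m : nat) (F : 'cV[R]_d -> R) (M : 'M[R]_d)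
  (v : R) (sigma : 'M[R]_(d, m)) (W : 'I_m -> R -> Omega -> R) (h : R)
  (p q : 'cV[R]_d) (n : nat) (w : Omega) : 'cV[R]_d * 'cV[R]_d :=
  match n with
  | 0%N => (p, q)
  | n'.+1 =>
      scheme_step F M v sigma h (scheme F M v sigma W h p q n' w)
        (\col_j (W j (n'.+1%:R * h) w - W j (n'%:R * h) w))
  end.

End Defs.

(* Main.v *)
(* The noise is additive up to terms of order [h]: with
   [c = (1 + vh/2) exp(-vh)], the quantity [P n + c sigma W(t_n)] together with
   [Q n] satisfies a linear recursion whose source terms are of order
   [h (1 + |W(t_n)| + |W(t_{n+1})|)].  A discrete Gronwall argument, applied path
   by path, bounds the scheme by
   [A (1 + |W(t_n)| + h \sum_(j <= n) |W(t_j)|)] with [A] independent of [h].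
   Powers are dominated by exponentials, and by convexity of [exp] the moment
   bound reduces to the Gaussian estimate
   [E exp(c |W_l(t_j)|) <= 2 exp(c^2 T / 2)]. *)

Require Import Defs.
From HB Require Import structures.
From mathcomp Require Import all_boot all_order all_algebra.
From mathcomp Require Import all_classical all_reals all_analysis.
From mathcomp Require Import measurable_realfun ring lra.
Set Implicit Arguments.
Unset Strict Implicit.
Unset Printing Implicit Defensive.

Import Order.TTheory GRing.Theory Num.Theory.
Import numFieldNormedType.Exports.
Local Open Scope classical_set_scope.
Local Open Scope ring_scope.

(** * Integration tools and Gaussian exponential moments *)

(** The integral of a nonnegative function is a supremum over the simple functions below it, a set
    that grows with the function. The moments of the scheme can thus be compared with an explicit
    exponential without proving the scheme measurable in [w]. *)
Lemma ge0_le_integral_nonmeasurable d (T : measurableType d) (R : realType)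
    (mu : {measure set T -> \bar R}) (f g : T -> \bar R) :
  (forall x, (0 <= f x)%E) -> (forall x, (f x <= g x)%E) ->
  (\int[mu]_x f x <= \int[mu]_x g x)%E.
Proof.
move=> f0 fg; have g0 x : (0 <= g x)%E by exact: le_trans (f0 x) (fg x).
rewrite !ge0_integralTE//; apply: ge_ereal_sup => _ [h hf <-].
by apply: ereal_sup_ubound; exists h => // x; apply: le_trans (hf x) (fg x).
Qed.

(** The Radon-Nikodym derivative of the normal law and [normal_pdf] have equal integrals over every
    measurable set, so they agree almost everywhere. *)
Lemma ge0_integral_normal_prob (R : realType) (m s : R) (f : measurableTypeR R -> \bar R) :
  (forall x, (0 <= f x)%E) -> measurable_fun [set: measurableTypeR R] f ->
  (\int[normal_prob m s]_x f x =
   \int[lebesgue_measure]_x (f x * (normal_pdf m s x)%:E))%E.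
Proof.
move=> f0 mf; have dom := normal_prob_dominates m s.
pose rn := Radon_Nikodym_SigmaFinite.f (normal_prob m s) (@lebesgue_measure R).
have rnint : lebesgue_measure.-integrable setT rn.
  exact: Radon_Nikodym_SigmaFinite.f_integrable.
rewrite -(Radon_Nikodym_SigmaFinite.change_of_variables dom)//.
apply: ge0_ae_eq_integral => //.
- by apply: emeasurable_funM => //; exact: (measurable_int _ rnint).
- apply: emeasurable_funM => //; apply/measurable_EFinP.
  exact: measurable_normal_pdf.
- by move=> x _; rewrite mule_ge0// Radon_Nikodym_SigmaFinite.f_ge0.
- by move=> x _; rewrite mule_ge0// lee_fin normal_pdf_ge0.
- apply: ae_eqe_mul2l; apply: integral_ae_eq => //.
  + by apply/measurable_EFinP; exact: measurable_normal_pdf.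
  + by move=> A _ mA; rewrite -Radon_Nikodym_SigmaFinite.f_integral.
Qed.

Lemma normal_mgf (R : realType) (s c : R) : s != 0 ->
  (\int[normal_prob 0 s]_x (expR (c * x))%:E = (expR (c ^+ 2 * s ^+ 2 / 2))%:E)%E.
Proof.
move=> s0.
have mexp : measurable_fun setT (fun x : R => (expR (c * x))%:E).
  by apply/measurable_EFinP; apply: measurableT_comp => //; exact: measurable_funM.
rewrite ge0_integral_normal_prob//.
(* Completing the square: the tilted centred density is a constant times the density with mean
   [c * s ^+ 2]. *)
transitivity (\int[lebesgue_measure]_x
   ((expR (c ^+ 2 * s ^+ 2 / 2))%:E * (normal_pdf (c * s ^+ 2) s x)%:E))%E.
  apply: eq_integral => x _; rewrite -!EFinM; congr EFin.
  rewrite !normal_pdfE// mulrCA [RHS]mulrCA /normal_fun -!expRD.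
  by congr (_ * expR _); field.
rewrite ge0_integralZl//.
- by rewrite integral_normal_pdf mule1.
- by apply/measurable_EFinP; exact: measurable_normal_pdf.
- by move=> x _; rewrite lee_fin normal_pdf_ge0.
Qed.

(** One of [expR (c * x)] and [expR (- c * x)] equals [expR (c * |x|)]; bounding by their sum costs
    the factor 2. *)
Lemma normal_exp_abs_le (R : realType) (s c : R) : s != 0 ->
  (\int[normal_prob 0 s]_x (expR (c * `|x|))%:E
    <= (2 * expR (c ^+ 2 * s ^+ 2 / 2))%:E)%E.
Proof.
move=> s0.
have mexp a : measurable_fun setT (fun x : R => (expR (a * x))%:E).
  by apply/measurable_EFinP; apply: measurableT_comp => //; exact: measurable_funM.
apply: (@le_trans _ _ (\int[normal_prob 0 s]_x
    ((expR (c * x))%:E + (expR (- c * x))%:E))%E).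
  apply: ge0_le_integral_nonmeasurable => x; first by rewrite lee_fin expR_ge0.
  rewrite -EFinD lee_fin; case: (ger0P x) => _.
    by rewrite lerDl expR_ge0.
  by rewrite mulrN mulNr lerDr expR_ge0.
rewrite ge0_integralD//; try exact: mexp.
by rewrite !normal_mgf// sqrrN -EFinD lee_fin mulr2n mulrDl mul1r.
Qed.

Lemma std_wiener_exp_abs_le (R : realType) (dO : measure_display)
    (Omega : measurableType dO) (Prob : probability Omega R) (m : nat)
    (W : 'I_m -> R -> Omega -> R) (l : 'I_m) (t T c : R) :
  std_wiener Prob W -> 0 <= t <= T ->
  (\int[Prob]_w (expR (c * `|W l t w|))%:E
    <= (2 * expR (c ^+ 2 * T / 2))%:E)%E.
Proof.
move=> [mW [W0 [_ incr]]] /andP[t0 tT].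
have c2 : 0 <= c ^+ 2 / 2 by rewrite divr_ge0 ?sqr_ge0.
(* The law of increments is given along strictly increasing times only, so [t = 0], where the
   integrand is 1, is separate. *)
move: t0; rewrite le_eqVlt => /predU1P[t0|t0].
  rewrite -t0 in tT *.
  under eq_integral do rewrite W0 normr0 mulr0 expR0.
  rewrite integral_cst// [X in (_ * X)%E](probability_setT Prob) mule1 lee_fin.
  have : 1 <= expR (c ^+ 2 * T / 2).
    by rewrite -[leLHS]expR0 ler_expR mulrAC mulr_ge0//.
  lra.
(* The two-point grid [0 < t]: its single increment is [W l t], as [W l 0 = 0]. *)
pose tt (i : nat) : R := if i is 0%N then 0 else t.
have tt0 : 0 <= tt 0%N by [].
have ttS i : (i < 1)%N -> tt i < tt i.+1 by case: i.
have [_ /(_ (l, ord0)) /= law] := incr 1%N tt tt0 ttS.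
pose X : {mfun Omega >-> measurableTypeR R} :=
  HB.pack (W l t) (isMeasurableFun.Build _ _ Omega (measurableTypeR R) _ (mW l t)).
have lawE B : measurable B -> distribution Prob X B = normal_prob 0 (Num.sqrt t) B.
  move=> mB; rewrite -[t in RHS]subr0 -law//.
  suff -> : (fun w => W l t w - W l 0 w) = W l t by [].
  by apply/funext => w; rewrite W0 subr0.
have mE : measurable_fun setT (fun x : R => (expR (c * `|x|))%:E).
  apply/measurable_EFinP; apply: measurableT_comp => //.
  by apply: measurable_funM => //; exact: measurableT_comp.
have -> : (\int[Prob]_w (expR (c * `|W l t w|))%:E =
    \int[normal_prob 0 (Num.sqrt t)]_x (expR (c * `|x|))%:E)%E.
  rewrite -(ge0_integral_distribution X mE) => [|x]; last first.
    by rewrite lee_fin expR_ge0.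
  by apply: eq_measure_integral => B mB _; exact: lawE.
apply: le_trans (normal_exp_abs_le c _) _; first by rewrite gt_eqF// sqrtr_gt0.
rewrite lee_fin ler_pM2l// ler_expR sqr_sqrtr ?(ltW t0)//.
by have := ler_wpM2l c2 tT; lra.
Qed.

(** * The entrywise maximum norm and the perturbed inverse *)

Section MatrixNorm.
Variable R : realType.

Lemma mx_entry_le_norm (m n : nat) (A : 'M[R]_(m, n)) i j : `|A i j| <= `|A|.
Proof.
rewrite [leRHS]/Num.norm /= mx_normrE.
by apply/bigmax_geP; right; exists (i, j).
Qed.

Lemma mx_norm_le (m n : nat) (A : 'M[R]_(m, n)) (c : R) :
  0 <= c -> (forall i j, `|A i j| <= c) -> `|A| <= c.
Proof.
move=> c0 Ac; rewrite [leLHS]/Num.norm /= mx_normrE.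
by apply/bigmax_leP; split => // -[i j] _; exact: Ac.
Qed.

(** The norm is the largest absolute entry, and each entry of the product is a sum of [n] terms. *)
Lemma mx_norm_mulmx (m n p : nat) (A : 'M[R]_(m, n)) (B : 'M[R]_(n, p)) :
  `|A *m B| <= n%:R * `|A| * `|B|.
Proof.
apply: mx_norm_le => [|i j]; first by rewrite !mulr_ge0.
rewrite mxE (le_trans (ler_norm_sum _ _ _))//.
have -> : n%:R * `|A| * `|B| = \sum_(k < n) `|A| * `|B|.
  by rewrite sumr_const card_ord -mulrA mulr_natl.
by apply: ler_sum => k _; rewrite normrM ler_pM// mx_entry_le_norm.
Qed.

Lemma enorm_ge0 (n : nat) (x : 'cV[R]_n) : 0 <= enorm x.
Proof. exact: sqrtr_ge0. Qed.

Lemma norm_le_enorm (n : nat) (x : 'cV[R]_n) : `|x| <= enorm x.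
Proof.
apply: mx_norm_le => [|i j]; first exact: enorm_ge0.
rewrite (ord1 j) -sqrtr_sqr ler_wsqrtr// (bigD1 i)//= lerDl.
by apply: sumr_ge0 => k _; rewrite sqr_ge0.
Qed.

Lemma enorm_le_norm (n : nat) (x : 'cV[R]_n) : enorm x <= n%:R * `|x|.
Proof.
rewrite -[leRHS]ger0_norm ?mulr_ge0// -sqrtr_sqr ler_wsqrtr//.
apply: (@le_trans _ _ (\sum_(i < n) `|x| ^+ 2)).
  apply: ler_sum => i _.
  by rewrite -real_normK ?num_real// lerXn2r ?nnegrE// mx_entry_le_norm.
rewrite sumr_const card_ord exprMn -[leLHS]mulr_natl ler_wpM2r ?sqr_ge0// -natrX ler_nat.
by case: n {x} => // n; rewrite leq_pmulr.
Qed.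

(* When [1 + B] is singular, [invmx] returns [1 + B] itself, for which the
   estimate holds as well; so no invertibility is needed. *)
Lemma mx_norm_invmx1D_sub (n : nat) (B : 'M[R]_n) (x : 'cV[R]_n) :
  n%:R * `|B| <= 1 / 2 ->
  `|invmx (1%:M + B) *m x - x| <= 2 * (n%:R * `|B|) * `|x|.
Proof.
move=> B2; have nB0 : 0 <= n%:R * `|B| by rewrite mulr_ge0.
have [u|/negbTE nu] := boolP (1%:M + B \in unitmx); last first.
  rewrite /invmx nu mulmxDl mul1mx addrAC subrr add0r.
  by apply: le_trans (mx_norm_mulmx _ _) _; rewrite ler_wpM2r//; lra.
set y := invmx _ *m x.
(* Here [y] solves [(1 + B) y = x]. *)
have yx : y - x = - (B *m y).
  have: (1%:M + B) *m y = x by rewrite mulKVmx.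
  by move=> <-; rewrite mulmxDl mul1mx opprD addrA subrr add0r.
have By : `|y - x| <= n%:R * `|B| * `|y| by rewrite yx normrN mx_norm_mulmx.
(* The smallness of [B] lets half of [|y|] be absorbed on the left. *)
have y2x : `|y| <= 2 * `|x|.
  have : `|y| <= `|y - x| + `|x| by have := ler_normD (y - x) x; rewrite subrK.
  have : n%:R * `|B| * `|y| <= 1 / 2 * `|y| by rewrite ler_wpM2r.
  lra.
apply: le_trans By _; rewrite mulrAC -mulrA mulrCA mulrC.
by rewrite [leRHS]mulrAC [leRHS]mulrC ler_wpM2l// mulrC.
Qed.

End MatrixNorm.

(** * The Hessian is bounded by the Lipschitz constant of the gradient *)

Section Hessian.
Variables (R : realType) (d : nat) (F : 'cV[R]_d -> R).
Hypothesis hF : smooth F.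

Lemma norm_ebasis_le1 (n : nat) (i : 'I_n) : `|ebasis R i| <= 1.
Proof.
by apply: mx_norm_le => // a b; rewrite mxE; case: (_ && _); rewrite ?normr1 ?normr0.
Qed.

(** Each entry is a limit of difference quotients of one gradient component, which the Lipschitz
    condition bounds; the factor [d] comes from comparing [enorm] with the maximum norm. *)
Lemma norm_hessian_le (L : R) (q : 'cV[R]_d) : 0 <= L ->
  (forall q1 q2, enorm (grad F q1 - grad F q2) <= L * enorm (q1 - q2)) ->
  `|hessian F q| <= L * d%:R.
Proof.
move=> L0 Lip; apply: mx_norm_le => [|i j]; first by rewrite mulr_ge0.
rewrite mxE.
have dif : differentiable ('D_(ebasis R j) F) q by exact: (hF [:: ebasis R j]).
have der := @diff_derivable _ _ _ _ _ (ebasis R i) dif.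
suff lims : (fun h : R => h^-1 *: (('D_(ebasis R j) F \o shift q) (h *: ebasis R i)
    - 'D_(ebasis R j) F q)) @ 0^' --> 'D_(ebasis R i) ('D_(ebasis R j) F) q.
  have limn : (fun h : R => `|h^-1 *: (('D_(ebasis R j) F \o shift q) (h *: ebasis R i)
    - 'D_(ebasis R j) F q)|) @ 0^' --> `|'D_(ebasis R i) ('D_(ebasis R j) F) q|.
    exact: cvg_norm.
  rewrite -(cvg_lim _ limn)//.
  apply: limr_le; first by apply/cvg_ex; eexists; exact: limn.
  near=> h => /=.
  have h0 : h != 0 by near: h; exact: nbhs_dnbhs_neq.
  rewrite normrZ normfV ler_pdivrMl ?normr_gt0//.
  have -> : 'D_(ebasis R j) F (h *: ebasis R i + q) - 'D_(ebasis R j) F q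
      = (grad F (h *: ebasis R i + q) - grad F q) j 0 by rewrite !mxE.
  apply: le_trans (mx_entry_le_norm _ _ _) _.
  apply: le_trans (norm_le_enorm _) _; apply: le_trans (Lip _ _) _.
  rewrite addrK mulrCA ler_wpM2l//; apply: le_trans (enorm_le_norm _) _.
  by rewrite mulrC ler_wpM2r// normrZ ler_piMr// norm_ebasis_le1.
exact: der.
Unshelve. all: by end_near. Qed.

End Hessian.

(** * One-step growth of the shifted scheme *)

Lemma norm_scale_le (R : realType) (V : normedModType R) (a a1 y : R) (x : V) :
  `|a| <= a1 -> `|x| <= y -> `|a *: x| <= a1 * y.
Proof. by move=> aa1 xy; rewrite normrZ ler_pM. Qed.

Lemma norm_sub3_le (R : realType) (V : normedModType R) (x y z : V) (a b c : R) :
  `|x| <= a -> `|y| <= b -> `|z| <= c -> `|x - y - z| <= a + b + c.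
Proof.
move=> xa yb zc; apply: le_trans (ler_normB _ _) _; apply: lerD => //.
by apply: le_trans (ler_normB _ _) _; apply: lerD.
Qed.

Lemma norm_add4_le (R : realType) (V : normedModType R) (x y z t : V) (a b c e : R) :
  `|x| <= a -> `|y| <= b -> `|z| <= c -> `|t| <= e ->
  `|x + y + z + t| <= a + b + c + e.
Proof.
move=> xa yb zc te; apply: le_trans (ler_normD _ _) _; apply: lerD => //.
apply: le_trans (ler_normD _ _) _; apply: lerD => //.
by apply: le_trans (ler_normD _ _) _; apply: lerD.
Qed.

Definition noise_coef (R : realType) (v h : R) : R :=
  (1 + v * h / 2) * expR (- (v * h)).

Lemma noise_coef_itv (R : realType) (v h : R) : 0 < v -> 0 < h <= 1 ->
  0 <= noise_coef v h <= 1 + v.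
Proof.
move=> v0 /andP[h0 h1].
have vh0 : 0 < v * h by rewrite mulr_gt0.
have vh1 : v * h <= v by rewrite ler_piMr// ltW.
have c0 : 0 <= 1 + v * h / 2 by lra.
rewrite /noise_coef mulr_ge0 ?expR_ge0//=.
apply: (@le_trans _ _ (1 + v * h / 2)); last lra.
by rewrite ler_piMr// -[leRHS]expR0 ler_expR; lra.
Qed.

Section Step.
Variables (R : realType) (d m : nat) (F : 'cV[R]_d -> R) (M : 'M[R]_d).
Variables (v g H : R) (sigma : 'M[R]_(d, m)).
Hypothesis v0 : 0 < v.
Hypothesis g0 : 0 <= g.
Hypothesis gradF : forall q, `|grad F q| <= g * (1 + `|q|).
Hypothesis hessF : forall q, `|hessian F q| <= H.

(* The noise enters the momentum equation with the constant coefficient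
   [c = noise_coef v h] up to an [O(h^2)] factor; shifting the momentum by
   [c sigma W(t_n)] thus leaves only increments of order [h]. *)
Lemma scheme_step_growth : exists h0 K : R, [/\ 0 < h0 <= 1, 0 <= K &
  forall (h : R) (x y : 'cV[R]_d) (s s' : 'cV[R]_m), 0 < h <= h0 ->
  `|(scheme_step F M v sigma h (x, y) (s' - s)).1
     + noise_coef v h *: (sigma *m s')|
  + `|(scheme_step F M v sigma h (x, y) (s' - s)).2| <=
    (1 + K * h) * (`|x + noise_coef v h *: (sigma *m s)| + `|y|)
    + K * h * (1 + `|s| + `|s'|)].
Proof.
have H0 : 0 <= H by exact: le_trans (hessF 0).
(* With [E] the common majorant introduced below, [beta * h ^+ 2] controls the implicit Hessian
   term, [nu] and [mu] the products by [sigma] and [M], [kP * E] the momentum [x], [kx * E] the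
   explicit right-hand side, and [h * b1] the coefficient of the new momentum in the position
   update. [K] collects all terms of order [h], so that the last step is an identity. *)
pose beta := d%:R * (d%:R * H * `|M|).
pose nu := m%:R * `|sigma|.
pose mu := d%:R * `|M|.
pose kP := 1 + (1 + v) * nu.
pose kx := kP + (1 + v) * g + (1 + v) * nu.
pose b1 := (1 + v) * expR v.
pose K := v * kP + (1 + v) * g + 2 * beta * kx
  + (2 * b1 * mu * kx + mu * g + mu * nu).
have beta0 : 0 <= beta by rewrite !mulr_ge0.
have nu0 : 0 <= nu by rewrite mulr_ge0.
have mu0 : 0 <= mu by rewrite mulr_ge0.
have v10 : 0 <= 1 + v by rewrite addr_ge0// ltW.
have kP0 : 0 <= kP by rewrite addr_ge0// mulr_ge0.
have kx0 : 0 <= kx by rewrite !addr_ge0// mulr_ge0.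
have b10 : 0 <= b1 by rewrite mulr_ge0// expR_ge0.
have K0 : 0 <= K by rewrite !addr_ge0// !mulr_ge0// ltW.
(* This threshold gives both [h <= 1] and [beta * h <= 1 / 2], the latter for the inverse of
   [1 + B]. *)
exists (1 / (1 + 2 * beta)), K; split => //.
  by rewrite divr_gt0 ?ltr_wpDr ?mulr_ge0// ler_pdivrMr ?ltr_wpDr ?mulr_ge0// mul1r lerDl mulr_ge0.
move=> h x y s s' /andP[h0 hh]; set z := scheme_step _ _ _ _ _ _ _.
have h1 : h <= 1.
  apply: le_trans hh _.
  by rewrite ler_pdivrMr ?ltr_wpDr ?mulr_ge0// mul1r lerDl mulr_ge0.
have bh : beta * h <= 1 / 2.
  move: hh; rewrite ler_pdivlMr ?ltr_wpDr ?mulr_ge0//.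
  by rewrite mulrDr mulr1 mulrCA (mulrC h); lra.
have h2h : h ^+ 2 <= h by rewrite expr2 ler_piMr// ltW.
have h20 : 0 <= h ^+ 2 by rewrite sqr_ge0.
have /andP[] : 0 <= noise_coef v h <= 1 + v by apply: noise_coef_itv => //; rewrite h0.
set c := noise_coef v h => c0 c1.
have cn : `|c| <= 1 + v by rewrite ger0_norm.
pose u := `|x + c *: (sigma *m s)| + `|y|.
(* [E] dominates every quantity of the step, and [u + K * h * E] is exactly the target bound. *)
pose E := 1 + u + `|s| + `|s'|.
have sE : `|s| <= E by rewrite /E /u; have := normr_ge0 s'; have := normr_ge0 y;
  have := normr_ge0 (x + c *: (sigma *m s)); lra.
have xcE : `|x + c *: (sigma *m s)| <= E by rewrite /E /u; have := normr_ge0 s';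
  have := normr_ge0 s; have := normr_ge0 y; lra.
have yE : 1 + `|y| <= E by rewrite /E /u; have := normr_ge0 s';
  have := normr_ge0 s; have := normr_ge0 (x + c *: (sigma *m s)); lra.
have ssE : `|s' - s| <= E.
  by apply: le_trans (ler_normB _ _) _; rewrite /E /u; have := normr_ge0 y;
  have := normr_ge0 (x + c *: (sigma *m s)); lra.
have E0 : 0 <= E by exact: le_trans sE.
have sig (t : 'cV[R]_m) : `|t| <= E -> `|sigma *m t| <= nu * E.
  move=> tE; apply: le_trans (mx_norm_mulmx _ _) _.
  by rewrite -/nu ler_wpM2l.
have Mn (t : 'cV[R]_d) e : `|t| <= e -> `|M *m t| <= mu * e.
  move=> tE; apply: le_trans (mx_norm_mulmx _ _) _.
  by rewrite -/mu ler_wpM2l.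
have xE : `|x| <= kP * E.
  rewrite -[x](addrK (c *: (sigma *m s))) mulrDl mul1r.
  apply: le_trans (ler_normB _ _) _; apply: lerD => //.
  by rewrite -mulrA; apply: norm_scale_le => //; exact: sig.
have fE : `|grad F y| <= g * E by apply: le_trans (gradF y) _; rewrite ler_wpM2l.
pose a := expR (- (v * h)).
have a0 : 0 <= a by exact: expR_ge0.
have vh0 : 0 <= v * h by rewrite mulr_ge0// ltW.
have a1 : a <= 1 by rewrite -[leRHS]expR0 ler_expR; lra.
have a1v : 1 - a <= v * h by have := expR_ge1Dx (- (v * h)); rewrite -/a; lra.
(* The momentum right-hand side before the implicit solve, which alters it only by order
   [h ^+ 2]. *)
pose w : 'cV[R]_d := a *: x - (h * (1 + v * h / 2) * a) *: grad F y
  - c *: (sigma *m (s' - s)).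
have hcE : h * (1 + v * h / 2) * a = h * c by rewrite /c /noise_coef mulrA.
have hcn : `|h * c| <= h * (1 + v).
  by rewrite normrM (ger0_norm (ltW h0)) ler_wpM2l// ltW.
have wE : `|w| <= kx * E.
  have -> : kx * E = 1 * (kP * E) + (1 + v) * (g * E) + (1 + v) * (nu * E).
    by rewrite /kx; ring.
  apply: norm_sub3_le; apply: norm_scale_le => //.
  - by rewrite ger0_norm.
  - by rewrite hcE; apply: le_trans hcn _; rewrite ler_piMl.
  - exact: sig.
pose B := (h ^+ 2 / 2) *: (hessian F y *m M).
have Bh : d%:R * `|B| <= beta * h ^+ 2.
  rewrite /beta -mulrA ler_wpM2l// mulrC.
  apply: norm_scale_le; first by rewrite ger0_norm; lra.
  apply: le_trans (mx_norm_mulmx _ _) _.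
  by rewrite ler_wpM2r// ler_wpM2l.
have Bhh : beta * h ^+ 2 <= 1 / 2.
  by apply: le_trans bh; rewrite ler_wpM2l.
have z1w : `|z.1 - w| <= 2 * (beta * h ^+ 2) * (kx * E).
  apply: le_trans (mx_norm_invmx1D_sub _ _) _; first exact: le_trans Bh Bhh.
  by apply: ler_pM => //; rewrite ler_pM2l.
have z1E : `|z.1| <= 2 * (kx * E).
  have := ler_normD (z.1 - w) w; rewrite subrK => zz.
  have : 2 * (beta * h ^+ 2) * (kx * E) <= 1 * (kx * E).
    by rewrite ler_wpM2r ?mulr_ge0//; lra.
  lra.
(* Adding [c sigma s'] turns the noise [- c sigma (s' - s)] into [c sigma s], the old shift; the
   damping [a - 1], the force and the implicit correction are all of order [h]. *)
have z1 : `|z.1 + c *: (sigma *m s')| <= `|x + c *: (sigma *m s)|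
    + v * h * (kP * E) + h * (1 + v) * (g * E) + 2 * (beta * h) * (kx * E).
  have -> : z.1 + c *: (sigma *m s') = (x + c *: (sigma *m s))
      + (a - 1) *: x + (- (h * c)) *: grad F y + (z.1 - w).
    rewrite /w hcE mulmxBr scalerBr scalerBl scale1r scaleNr.
    apply/matrixP => i j; rewrite !mxE; ring.
  apply: norm_add4_le => //.
  - by apply: norm_scale_le => //; rewrite ler0_norm; lra.
  - by apply: norm_scale_le; rewrite ?normrN.
  - apply: le_trans z1w _; rewrite ler_wpM2r ?mulr_ge0//.
    by rewrite ler_pM2l// ler_wpM2l.
have bn : `|h * (1 - v * h / 2) * expR (v * h)| <= h * b1.
  rewrite -mulrA normrM (ger0_norm (ltW h0)) ler_wpM2l ?(ltW h0)//.
  have vhv : v * h <= v by rewrite ler_piMr// ltW.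
  rewrite normrM (ger0_norm (expR_ge0 _)) ler_pM// ?expR_ge0// ?ler_expR//.
  by rewrite ler_norml; apply/andP; split; lra.
have z2 : `|z.2| <= `|y| + h * b1 * (mu * (2 * (kx * E)))
    + h * (mu * (g * E)) + h * (mu * (nu * E)).
  apply: norm_add4_le => //.
  - by apply: norm_scale_le => //; exact: Mn.
  - by apply: norm_scale_le; [rewrite ger0_norm; lra | exact: Mn].
  - apply: norm_scale_le; first by rewrite ger0_norm; lra.
    by apply: Mn; exact: sig.
apply: le_trans (lerD z1 z2) _.
have -> : (1 + K * h) * (`|x + c *: (sigma *m s)| + `|y|)
    + K * h * (1 + `|s| + `|s'|) = u + K * h * E by rewrite /E /u; ring.
by rewrite le_eqVlt; apply/orP; left; apply/eqP; rewrite /K /u; ring.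
Qed.

End Step.

(** * Gronwall and the pathwise bound *)

(** By induction: [1 + k <= expR k] carries the earlier terms along, and the newest source is merely
    multiplied by an exponential that is at least 1. *)
Lemma discrete_gronwall (R : realType) (k : R) (u g : nat -> R) : 0 <= k ->
  (forall n, 0 <= u n) -> (forall n, 0 <= g n) ->
  (forall n, u n.+1 <= (1 + k) * u n + k * g n) ->
  forall n, u n <= expR (k * n%:R) * (u 0%N + k * \sum_(j < n) g j).
Proof.
move=> k0 u0 g0 rec; elim=> [|n IH].
  by rewrite mulr0 expR0 mul1r big_ord0 mulr0 addr0.
apply: le_trans (rec n) _; rewrite big_ord_recr/= (mulrDr k) addrA (mulrDr (expR _)).
apply: lerD.
  have -> : expR (k * n.+1%:R) = expR k * expR (k * n%:R).
    by rewrite -expRD -natr1; congr expR; ring.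
  by rewrite -mulrA; apply: ler_pM => //; [rewrite addr_ge0|exact: expR_ge1Dx].
rewrite -[leLHS]mul1r ler_wpM2r ?mulr_ge0// -[leLHS]expR0 ler_expR mulr_ge0//.
Qed.

(** The sum over coordinates keeps the pathwise bound linear in the [|W l t|], the form to which
    convexity of [expR] is applied later. *)
Definition l1_at (R : realType) (m : nat) (Omega : Type)
    (W : 'I_m -> R -> Omega -> R) (w : Omega) (t : R) : R :=
  \sum_l `|W l t w|.

Section Path.
Variables (R : realType) (d m : nat) (F : 'cV[R]_d -> R) (M : 'M[R]_d).
Variables (v g H T : R) (sigma : 'M[R]_(d, m)) (p q : 'cV[R]_d).
Hypothesis v0 : 0 < v.
Hypothesis g0 : 0 <= g.
Hypothesis gradF : forall y, `|grad F y| <= g * (1 + `|y|).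
Hypothesis hessF : forall y, `|hessian F y| <= H.

Lemma scheme_pathwise_bound : exists h0 A : R, [/\ 0 < h0 <= 1, 0 <= A &
  forall (Omega : Type) (W : 'I_m -> R -> Omega -> R) (w : Omega) (h : R) (n : nat),
  (forall l, W l 0 w = 0) -> 0 < h <= h0 -> n%:R * h <= T ->
  Num.max (enorm (scheme F M v sigma W h p q n w).1)
          (enorm (scheme F M v sigma W h p q n w).2) <=
    A * (1 + l1_at W w (n%:R * h) + h * \sum_(j < n.+1) l1_at W w (j%:R * h))].
Proof.
have [h0 [K [/andP[h00 h01] K0 step]]] := scheme_step_growth M sigma v0 g0 gradF hessF.
pose nu := m%:R * `|sigma|.
have nu0 : 0 <= nu by rewrite mulr_ge0.
(* Gronwall runs with [k = K * h] over [n * h <= T], whence the exponential. In the second factor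
   stand the initial value, the total [K * |T|] of the constant sources, and [2 * K] because each
   Wiener value occurs in at most two sources. *)
pose G := expR (K * `|T|) * (`|p| + `|q| + K * `|T| + 2 * K).
have G0 : 0 <= G by rewrite mulr_ge0 ?expR_ge0// !addr_ge0// !mulr_ge0.
have v10 : 0 <= 1 + v by rewrite addr_ge0// ltW.
exists h0, (d%:R * (G + (1 + v) * nu)); split.
- by rewrite h00.
- by rewrite mulr_ge0// addr_ge0// mulr_ge0.
move=> Omega W w h n W0 /andP[hgt hh] nhT.
set Z := scheme _ _ _ _ _ _ _ _ _ _.
pose S j := l1_at W w (j%:R * h).
rewrite -/(S n).
have h1 : h <= 1 by exact: le_trans hh h01.
have /andP[] : 0 <= noise_coef v h <= 1 + v by apply: noise_coef_itv => //; rewrite hgt.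
set c := noise_coef v h => c0 c1.
pose V j : 'cV[R]_m := \col_l W l (j%:R * h) w.
have VS j : `|V j| <= S j.
  apply: mx_norm_le => [|l i]; first exact: sumr_ge0.
  by rewrite mxE /S /l1_at (bigD1 l)//= lerDl sumr_ge0.
have S0 j : 0 <= S j by exact: sumr_ge0.
pose z j := scheme F M v sigma W h p q j w.
pose u j := `|(z j).1 + c *: (sigma *m V j)| + `|(z j).2|.
have Kh0 : 0 <= K * h by rewrite mulr_ge0// ltW.
have urec j : u j.+1 <= (1 + K * h) * u j + K * h * (1 + S j + S j.+1).
  have := step h (z j).1 (z j).2 (V j) (V j.+1); rewrite hgt hh => /(_ isT).
  have -> : scheme_step F M v sigma h ((z j).1, (z j).2) (V j.+1 - V j) = z j.+1.
    rewrite -surjective_pairing /z/=; congr scheme_step.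
    by apply/matrixP => l i; rewrite !mxE.
  move=> /le_trans; apply; rewrite -/c -/(u j) lerD2l ler_wpM2l//.
  by rewrite lerD// lerD.
have u00 : u 0%N = `|p| + `|q|.
  rewrite /u /z/=; suff -> : V 0%N = 0 by rewrite mulmx0 scaler0 addr0.
  by apply/matrixP => l i; rewrite !mxE mul0r W0.
have u0 j : 0 <= u j by rewrite addr_ge0.
have g1 j : 0 <= 1 + S j + S j.+1 by rewrite !addr_ge0.
have := discrete_gronwall Kh0 u0 g1 urec n; rewrite u00.
set sg := \sum_(j < n) _ => un.
(* The index runs up to [n] included, since the last source contains [S n]. *)
set sS := \sum_(j < n.+1) S j.
have sS0 : 0 <= sS by exact: sumr_ge0.
have sgS : sg <= n%:R + 2 * sS.
  rewrite /sg !big_split/= sumr_const card_ord -addrA lerD2l mulr2n mulrDl mul1r.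
  apply: lerD.
  - by rewrite /sS big_ord_recr/= lerDl.
  - by rewrite /sS big_ord_recl/= lerDr.
have nhT' : n%:R * h <= `|T| by apply: le_trans nhT (ler_norm _).
have hsS0 : 0 <= h * sS by rewrite mulr_ge0// ltW.
have uG : u n <= G * (1 + h * sS).
  apply: le_trans un _; rewrite /G -[leRHS]mulrA; apply: ler_pM.
  - exact: expR_ge0.
  - by rewrite addr_ge0// mulr_ge0//; apply: sumr_ge0.
  - by rewrite ler_expR -mulrA ler_wpM2l// mulrC.
  have e1 : K * h * sg <= K * h * (n%:R + 2 * sS) by rewrite ler_wpM2l.
  have e2 : K * (n%:R * h) <= K * `|T| by rewrite ler_wpM2l.
  have e3 : 0 <= (`|p| + `|q| + K * `|T|) * (h * sS).
    by rewrite mulr_ge0// !addr_ge0// mulr_ge0.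
  have -> : (`|p| + `|q| + K * `|T| + 2 * K) * (1 + h * sS) = (`|p| + `|q| + K * `|T|)
    + (`|p| + `|q| + K * `|T|) * (h * sS) + 2 * K + 2 * (K * (h * sS)) by ring.
  have e4 : K * h * (n%:R + 2 * sS) = K * (n%:R * h) + 2 * (K * (h * sS)) by ring.
  rewrite e4 in e1; lra.
(* Removing the shift at the final time produces the separate term in [S n], which has no factor
   [h]. *)
have noise : `|c *: (sigma *m V n)| <= (1 + v) * nu * S n.
  rewrite -mulrA; apply: norm_scale_le; first by rewrite ger0_norm.
  by apply: le_trans (mx_norm_mulmx _ _) _; rewrite ler_wpM2l.
have P1 : `|Z.1| <= u n + (1 + v) * nu * S n.
  rewrite -[Z.1](addrK (c *: (sigma *m V n))).
  apply: le_trans (ler_normB _ _) _; apply: lerD => //.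
  by rewrite /u lerDl.
have Q1 : `|Z.2| <= u n + (1 + v) * nu * S n.
  rewrite -[leLHS]addr0 lerD ?mulr_ge0//.
  by rewrite /u lerDr.
have tot : u n + (1 + v) * nu * S n <= (G + (1 + v) * nu) * (1 + S n + h * sS).
  have f1 : 0 <= G * S n by rewrite mulr_ge0.
  have f2 : 0 <= (1 + v) * nu by rewrite mulr_ge0.
  have f3 : 0 <= (1 + v) * nu * (h * sS) by rewrite mulr_ge0.
  have -> : (G + (1 + v) * nu) * (1 + S n + h * sS) = G * (1 + h * sS) + G * S n
    + (1 + v) * nu + (1 + v) * nu * S n + (1 + v) * nu * (h * sS) by ring.
  lra.
rewrite ge_max; apply/andP; split; apply: le_trans (enorm_le_norm _) _;
  rewrite -mulrA ler_wpM2l//.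
  exact: le_trans P1 tot.
exact: le_trans Q1 tot.
Qed.

End Path.

(** * From the pathwise bound to moments *)

(** For positive [k], raise [y / k <= expR (y / k)] to the power [k]; for [k = 0] both powers are
    1. *)
Lemma exprn_le_expR (R : realType) (k : nat) (y : R) : 0 <= y ->
  y ^+ k <= k%:R ^+ k * expR y.
Proof.
case: k => [|k] y0; first by rewrite !expr0 mul1r -[leLHS]expR0 ler_expR.
have k0 : (0 : R) < k.+1%:R by rewrite ltr0n.
have -> : expR y = expR (y / k.+1%:R) ^+ k.+1.
  by rewrite -expRM_natl mulrC divfK// gt_eqF.
rewrite -exprMn lerXn2r ?nnegrE ?mulr_ge0 ?expR_ge0//.
rewrite mulrC -ler_pdivrMr//; apply: le_trans (expR_ge1Dx _).
by rewrite lerDr.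
Qed.

(* Jensen: the missing mass [1 - \sum_i lam i] sits at [0]. *)
Lemma expR_subconvex (R : realType) (I : finType) (lam z : I -> R) :
  (forall i, 0 <= lam i) -> \sum_i lam i <= 1 ->
  expR (\sum_i lam i * z i) <= 1 + \sum_i lam i * expR (z i).
Proof.
move=> lam0 lam1; set y := \sum_i lam i * z i; set L := \sum_i lam i in lam1 *.
(* The tangent of [expR] at [y] lies below its graph. Averaged over the [z i] with weights [lam i]
   and over [0] with weight [1 - L], it gives exactly [expR y]. *)
have tangent t : expR y * (1 + t - y) <= expR t.
  have -> : expR t = expR y * expR (t - y) by rewrite -expRD addrC subrK.
  by rewrite ler_wpM2l ?expR_ge0//; have := expR_ge1Dx (t - y); rewrite addrA.
have sum_tangent : expR y * (L + y - y * L) <= \sum_i lam i * expR (z i).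
  have -> : expR y * (L + y - y * L) = \sum_i lam i * (expR y * (1 + z i - y)).
    have -> : L + y - y * L = \sum_i (lam i + lam i * z i - y * lam i).
      by rewrite sumrB big_split/= -mulr_sumr.
    by rewrite mulr_sumr; apply: eq_bigr => i _; ring.
  by apply: ler_sum => i _; rewrite ler_wpM2l.
have L0 : 0 <= L by exact: sumr_ge0.
have := tangent 0; rewrite expR0 addr0 => t0.
have : (1 - L) * (expR y * (1 - y)) <= (1 - L) * 1 by rewrite ler_wpM2l// subr_ge0.
have -> : (1 - L) * (expR y * (1 - y)) = expR y - expR y * (L + y - y * L) by ring.
lra.
Qed.

(** Apply [expR_subconvex] with weights [mu i / c] and exponents [c * |X i|]. The bound does not
    grow with the cardinality of [I], so the number of time steps may tend to infinity as [h]
    decreases. *)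
Lemma integral_expR_sum_le d (T : measurableType d) (R : realType)
    (P : probability T R) (I : finType) (mu : I -> R) (X : I -> T -> R) (c b : R) :
  0 < c -> 0 <= b -> (forall i, 0 <= mu i) -> \sum_i mu i <= c ->
  (forall i, measurable_fun setT (X i)) ->
  (forall i, \int[P]_w (expR (c * `|X i w|))%:E <= b%:E)%E ->
  (\int[P]_w (expR (\sum_i mu i * `|X i w|))%:E <= (1 + b)%:E)%E.
Proof.
move=> c0 b0 mu0 muc mX Xb.
pose lam i := mu i / c.
have lam0 i : 0 <= lam i by rewrite divr_ge0// ltW.
have lam1 : \sum_i lam i <= 1 by rewrite -mulr_suml ler_pdivrMr// mul1r.
have mE i : measurable_fun setT (fun w => (expR (c * `|X i w|))%:E).
  apply/measurable_EFinP; apply: measurableT_comp => //.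
  by apply: measurable_funM => //; exact: measurableT_comp.
have mlE i : measurable_fun setT (fun w => ((lam i)%:E * (expR (c * `|X i w|))%:E)%E).
  by apply: emeasurable_funM.
have lE0 i w : (0 <= (lam i)%:E * (expR (c * `|X i w|))%:E)%E.
  by apply: mule_ge0; rewrite lee_fin ?expR_ge0.
apply: (@le_trans _ _ (\int[P]_w
    (1%:E + \sum_i (lam i)%:E * (expR (c * `|X i w|))%:E))%E).
  apply: ge0_le_integral_nonmeasurable => w; first by rewrite lee_fin expR_ge0.
  have -> : (\sum_i (lam i)%:E * (expR (c * `|X i w|))%:E)%E =
      (\sum_i lam i * expR (c * `|X i w|))%:E.
    by rewrite -sumEFin; apply: eq_bigr => i _; rewrite EFinM.
  rewrite -EFinD lee_fin.
  rewrite (eq_bigr (fun i => lam i * (c * `|X i w|))); last first.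
    by move=> i _; rewrite mulrA divfK// gt_eqF.
  exact: expR_subconvex.
rewrite ge0_integralD//; last 2 first.
- by move=> w _; exact: sume_ge0.
- exact: emeasurable_sum.
rewrite integral_cst// [X in (_ * X)%E](probability_setT P) mule1 EFinD leeD2l//.
rewrite ge0_integral_sum//.
apply: (@le_trans _ _ (\sum_i (lam i * b)%:E)%E).
  apply: lee_sum => i _; rewrite ge0_integralZl//; last by rewrite lee_fin.
  by rewrite (EFinM (lam i)) lee_wpmul2l// lee_fin.
by rewrite sumEFin lee_fin -mulr_suml ler_piMl.
Qed.

Theorem theorem4p2 (R : realType) (dO : measure_display)
  (Omega : measurableType dO) (Prob : probability Omega R)
  (d m : nat) (hdm : (d <= m)%N)
  (F : 'cV[R]_d -> R) (hF : smooth F)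
  (M : 'M[R]_d) (hM : sym_pos_def M) (v : R) (hv : 0 < v)
  (sigma : 'M[R]_(d, m))
  (W : 'I_m -> R -> Omega -> R) (hW : std_wiener Prob W)
  (L Cf : R) (hL : 0 <= L) (hCf : 0 <= Cf)
  (hLip : forall q1 q2 : 'cV[R]_d,
      enorm (grad F q1 - grad F q2) <= L * enorm (q1 - q2))
  (hgrowth : forall q : 'cV[R]_d, enorm (grad F q) <= Cf * (1 + enorm q))
  (T : R) (hT : 0 < T) (k : nat) (p q : 'cV[R]_d) :
  exists h0 : R, 0 < h0 /\
  exists C : R, forall (h : R) (N : nat), 0 < h -> h <= h0 -> T = N%:R * h ->
    forall n : nat, (1 <= n <= N)%N ->
      (\int[Prob]_w ((enorm (scheme F M v sigma W h p q n w).1) ^+ k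
                    + (enorm (scheme F M v sigma W h p q n w).2) ^+ k)%:E
        <= C%:E)%E.
Proof.
(* Linear growth passes to the maximum norm through [1 + d |y| <= (1 + d) (1 + |y|)]. *)
pose g := Cf * (1 + d%:R).
have g0 : 0 <= g by rewrite mulr_ge0// addr_ge0.
have gradF y : `|grad F y| <= g * (1 + `|y|).
  apply: le_trans (norm_le_enorm _) _; apply: le_trans (hgrowth y) _.
  rewrite /g -mulrA ler_wpM2l//.
  have := enorm_le_norm y; have : 0 <= d%:R :> R by [].
  have := normr_ge0 y; rewrite mulrDr mulr1 mulrDl mul1r; lra.
have hessF y := norm_hessian_le hF y hL hLip.
have [h0 [A [/andP[h00 h01] A0 path]]] :=
  scheme_pathwise_bound M T sigma p q hv g0 gradF hessF.
have [mW [W0 _]] := hW.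
(* The weights [mu] below sum to [m A ((n + 1) h + 1)], at most [m A (T + 2)] as [n h <= T] and
   [h <= 1]; the added 1 makes [c] positive. *)
pose c := m%:R * (A * (T + 2)) + 1.
have c0 : 0 < c by rewrite ltr_wpDl// !mulr_ge0// addr_ge0// ltW.
pose b := 2 * expR (c ^+ 2 * T / 2).
have b0 : 0 <= b by rewrite mulr_ge0// expR_ge0.
(* The factor 2 is for the two summands, the power of [k] for [exprn_le_expR], and [expR A] for the
   deterministic part of the pathwise bound. *)
pose D := 2 * k%:R ^+ k * expR A.
have D0 : 0 <= D by rewrite !mulr_ge0 ?expR_ge0// exprn_ge0.
exists h0; split => //; exists (D * (1 + b)) => h N hgt hh TN n /andP[_ nN].
have nT : n%:R * h <= T by rewrite TN ler_pM2r// ler_nat.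
(* Each time carries weight [A * h] from the Riemann sum; the last one, [ord_max], also carries [A]
   from the term at [t_n]. *)
pose mu (jl : 'I_n.+1 * 'I_m) : R := A * (h + (jl.1 == ord_max)%:R).
pose X (jl : 'I_n.+1 * 'I_m) (w : Omega) := W jl.2 (jl.1%:R * h) w.
have mu0 jl : 0 <= mu jl by rewrite mulr_ge0// addr_ge0// ltW.
have muc : \sum_jl mu jl <= c.
  rewrite -(pair_bigA _ (fun (j : 'I_n.+1) (l : 'I_m) => mu (j, l)))/=.
  rewrite (eq_bigr (fun j : 'I_n.+1 => m%:R * (A * (h + (j == ord_max)%:R)))); last first.
    by move=> j _; rewrite /mu/= sumr_const card_ord mulr_natl.
  rewrite -!mulr_sumr big_split/= sumr_const card_ord.
  rewrite (bigD1 ord_max)//= eqxx big1 ?addr0; last by move=> j /negbTE ->.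
  rewrite /c ler_wpDr// !ler_wpM2l// -[h *+ _]mulr_natl -natr1 mulrDl mul1r/=.
  have h1 := le_trans hh h01; lra.
have pathE w : A * (1 + l1_at W w (n%:R * h)
    + h * \sum_(j < n.+1) l1_at W w (j%:R * h)) = A + \sum_jl mu jl * `|X jl w|.
  have -> : \sum_jl mu jl * `|X jl w|
      = \sum_(j < n.+1) A * (h + (j == ord_max)%:R) * l1_at W w (j%:R * h).
    rewrite -(pair_bigA _ (fun (j : 'I_n.+1) (l : 'I_m) => mu (j, l) * `|X (j, l) w|))/=.
    by apply: eq_bigr => j _; rewrite /mu /X /l1_at/= mulr_sumr.
  rewrite -addrA mulrDr mulr1; congr (A + _).
  under [RHS]eq_bigr do rewrite mulrDr mulrDl.
  rewrite big_split/= -mulr_sumr addrC mulrDr mulrA; congr (_ + _).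
  rewrite (bigD1 ord_max)//= eqxx mulr1 big1 ?addr0// => j /negbTE ->.
  by rewrite mulr0 mul0r.
have Eb jl : (\int[Prob]_w (expR (c * `|X jl w|))%:E <= b%:E)%E.
  apply: std_wiener_exp_abs_le => //; rewrite mulr_ge0 ?(ltW hgt)//=.
  by apply: le_trans nT; rewrite ler_pM2r// ler_nat -ltnS.
have mX jl : measurable_fun setT (X jl) by exact: mW.
have Eexp := integral_expR_sum_le c0 b0 mu0 muc mX Eb.
have mexp : measurable_fun setT (fun w => (expR (\sum_jl mu jl * `|X jl w|))%:E).
  apply/measurable_EFinP; apply: measurableT_comp => //.
  apply: measurable_sum => jl; apply: measurable_funM => //.
  by apply: measurableT_comp => //; exact: mX.
apply: (@le_trans _ _ (\int[Prob]_w
    (D%:E * (expR (\sum_jl mu jl * `|X jl w|))%:E))%E).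
  apply: ge0_le_integral_nonmeasurable => w.
    by rewrite lee_fin addr_ge0// exprn_ge0// enorm_ge0.
  rewrite -EFinM lee_fin.
  have := path Omega W w h n (fun l => W0 l w); rewrite hgt hh => /(_ isT nT).
  rewrite pathE ge_max => /andP[].
  set Z := scheme _ _ _ _ _ _ _ _ _ _; set r := A + _ => Z1 Z2.
  have pow y : 0 <= y -> y <= r -> y ^+ k <= k%:R ^+ k * expR r.
    move=> y0 yr; apply: le_trans (exprn_le_expR k y0) _.
    by rewrite ler_wpM2l ?exprn_ge0// ler_expR.
  apply: le_trans (lerD (pow _ (enorm_ge0 _) Z1) (pow _ (enorm_ge0 _) Z2)) _.
  by rewrite /D /r expRD le_eqVlt; apply/orP; left; apply/eqP; ring.
rewrite ge0_integralZl//.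
by rewrite (EFinM D) lee_wpmul2l.
Qed.
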